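(* Let $K$ be a $b$-complete idempotent semiring, $X$ a nonempty set, $W$ a $b$-complete semimodule over $K$, and $V\subset K(X)$ an admissible functional $\wedge$-semimodule. Then each $b$-linear operator $A:V\to W$ has an integral representation, i.e. there is a mapping $k:X\to W$ such that for every $f\in V$ the set $\{f(x)\odot k(x)\mid x\in X\}$ is bounded in $W$ and $$Af=\bigoplus_{x\in X} f(x)\odot k(x).$$ In particular, if $W$ is a functional $b$-semimodule on a nonempty set $Y$, then there is a function $k:X\times Y\to K$, with $k(x,\cdot)\in W$ for every $x\in X$ and with $\{f(x)\odot k(x,\cdot)\mid x\in X\}$ bounded in $W$ for every $f\in V$, such that $$(Af)(y)=\bigoplus_{x\in X} f(x)\odot k(x,y)\qquad (f\in V,\ y\in Y).$$ Thus the kernel theorem holds for $V$.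
   Context: An idempotent semigroup is a commutative semigroup $(S,\oplus)$ with $x\oplus x=x$ for all $x$. It carries the standard order $x\preceq y \iff x\oplus y=y$, so $x\oplus y=\sup\{x,y\}$; write $\oplus X=\sup X$ when it exists. ''Bounded'' means bounded from above. $S$ is $b$-complete if every bounded subset, including $\varnothing$, has a least upper bound; then $\mathbf 0=\oplus\varnothing$ is the zero (least) element. An idempotent semiring $K$ is an idempotent semigroup with an associative (not necessarily commutative) multiplication $\odot$ with identity $\mathbf 1$ and both distributive laws; it is $b$-complete if it is a $b$-complete semigroup and $k\odot(\oplus Q)=\oplus(k\odot Q)$, $(\oplus Q)\odot k=\oplus(Q\odot k)$ for all $k\in K$ and bounded $Q\subset K$. A (left, idempotent) semimodule $V$ over $K$ is an idempotent semigroup with zero $\mathbf 0$ and a multiplication $k\odot x$ ($k\in K$, $x\in V$) with $a\odot(b\odot x)=(a\odot b)\odot x$, $(a\oplus b)\odot x=a\odot x\oplus b\odot x$, $a\odot(x\oplus y)=a\odot x\oplus a\odot y$, $\mathbf 0\odot x=\mathbf 0$, $\mathbf 1\odot x=x$. $V$ (over $b$-complete $K$) is $b$-complete if it is a $b$-complete semigroup and $k\odot\oplus S=\oplus(k\odot S)$, $(\oplus Q)\odot v=\oplus(Q\odot v)$ for all $k\in K$, $v\in V$ and bounded $S\subset V$, $Q\subset K$. A homomorphism $g:V\to W$ of $b$-complete semimodules (additive, $g(a\odot x)=a\odot g(x)$) is $b$-linear if $g(\oplus S)=\oplus g(S)$ for every bounded $S\subset V$. $K(X)$ is the semimodule of all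 functions $X\to K$ with pointwise operations. A functional semimodule on $X$ is a quasisubsemimodule of $K(X)$: a subset $V\subset K(X)$ closed under multiplication by scalars, which is an upper semilattice in the order induced from $K(X)$, and which is a semimodule over $K$ when addition is defined by $x\oplus y=\sup\{x,y\}$ with the supremum taken in $V$ (this need not be the pointwise sum). A functional $\wedge$-semimodule is a functional semimodule $V$ that contains $\mathbf 0$ and is closed under taking infima in $K(X)$ of its nonempty subsets (such a $V$ is automatically a $b$-complete semimodule). A functional $b$-semimodule on a set is a $b$-subsemimodule of $K(\cdot)$: a subsemimodule (closed under pointwise addition and scalar multiplication) that is itself $b$-complete and whose inclusion is $b$-linear, i.e. suprema in it of subsets bounded in it are the pointwise suprema. A functional semimodule $V\subset K(X)$ is admissible if for each $f\in V$ and each $x\in X$ with $f(x)\ne\mathbf 0$ there is $g\in V$ with $g(x)=\mathbf 1$ and $f(x)\odot g\preceq f$. The kernel theorem holds for a $b$-complete functional semimodule $V\subset K(X)$ if for every $b$-complete semimodule $W$ over $K$, every $b$-linear mapping $A:V\to W$ has an integral representation as in the first displayed formula. *)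

(* Defs.v *)
(* Written in the MathComp / MathComp-Analysis (classical layer) world. *)
From HB Require Import structures.
From mathcomp Require Import all_boot all_algebra.
From mathcomp Require Export boolp classical_sets functions.

Set Implicit Arguments.
Unset Strict Implicit.
Unset Printing Implicit Defensive.

Import GRing.Theory.
Local Open Scope classical_set_scope.
Local Open Scope ring_scope.

(* Idempotent sums are written with the library's +, *, *:, 0, 1.  A b-complete
   idempotent semiring satisfies 0 * x = x * 0 = 0 (distributivity over the
   supremum of the empty set), so nothing is lost by starting from
   pzSemiRingType, whose axioms include these laws; 0 = 1 is allowed and
   multiplication need not commute. *)
HB.mixin Record Nmodule_isIdempotent S of GRing.Nmodule S := {
  addii : idempotent_op (@GRing.add S)
}.

#[short(type="idemSemiRingType")]
HB.structure Definition IdemSemiRing :=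
  {K of GRing.PzSemiRing K & Nmodule_isIdempotent K}.

Section StandardOrder.
Variable S : nmodType.
Implicit Types (x y s : S) (Q : set S).

(* The standard order of an idempotent semigroup; on X -> K it is the pointwise
   order. *)
Definition preceq x y : Prop := x + y = y.

Definition is_ub Q s : Prop := forall q, Q q -> preceq q s.
Definition is_lb Q s : Prop := forall q, Q q -> preceq s q.
Definition bounded Q : Prop := exists s, is_ub Q s.

Definition is_lub Q s : Prop :=
  is_ub Q s /\ forall t, is_ub Q t -> preceq s t.

Definition is_glb Q s : Prop :=
  is_lb Q s /\ forall t, is_lb Q t -> preceq t s.

(* Least upper bound taken inside a subset P with the induced order. *)
Definition is_lub_in (P Q : set S) s : Prop :=
  [/\ P s, is_ub Q s & forall t, P t -> is_ub Q t -> preceq s t].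

(* Q = set0 is bounded; its least upper bound is then the neutral element 0. *)
Definition b_complete_semigroup : Prop :=
  idempotent_op (@GRing.add S) /\ forall Q, bounded Q -> exists s, is_lub Q s.

End StandardOrder.

Notation "x ⪯ y" := (preceq x y) (at level 70, no associativity).

(* Least upper bounds are unique and their existence entails boundedness, so
   an identity "F (sup Q) = sup (F Q) for bounded Q" between existing suprema is
   written "is_lub Q s -> is_lub (F @` Q) (F s)". *)

Definition b_complete_semiring (K : idemSemiRingType) : Prop :=
  [/\ b_complete_semigroup K,
      forall (k : K) (Q : set K) (q : K),
        is_lub Q q -> is_lub [set k * x | x in Q] (k * q)
    & forall (k : K) (Q : set K) (q : K),
        is_lub Q q -> is_lub [set x * k | x in Q] (q * k)].

(* An lSemiModType over an idempotent K is an idempotent semimodule: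
   x + x = (1 + 1) *: x = x. *)
Definition b_complete_semimodule (K : idemSemiRingType) (V : lSemiModType K) :
    Prop :=
  [/\ b_complete_semigroup V,
      forall (k : K) (Q : set V) (s : V),
        is_lub Q s -> is_lub [set k *: x | x in Q] (k *: s)
    & forall (v : V) (Q : set K) (q : K),
        is_lub Q q -> is_lub [set k *: v | k in Q] (q *: v)].

Definition b_linear (K : idemSemiRingType) (V W : lSemiModType K)
    (A : {linear V -> W}) : Prop :=
  forall (Q : set V) (s : V), is_lub Q s -> is_lub (A @` Q) (A s).

(* The sum of f and g in a functional semimodule is their supremum in the
   subset.  The fields state, in terms of such suprema, the semimodule axioms
   that are not automatic for a subset closed under scalar multiplication and
   binary suprema; fs_inh provides the zero 0 \*o f, i.e. the zero function. *)
Record functional_semimodule (K : idemSemiRingType) (X : Type) := {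
  fs_set : set (X -> K);
  fs_inh : fs_set !=set0;
  fs_scale : forall (a : K) f, fs_set f -> fs_set (a \*o f);
  fs_join : forall f g, fs_set f -> fs_set g ->
    exists h, is_lub_in fs_set [set f; g] h;
  fs_scaleDr : forall (a : K) f g h, fs_set f -> fs_set g ->
    is_lub_in fs_set [set f; g] h ->
    is_lub_in fs_set [set a \*o f; a \*o g] (a \*o h);
  fs_scaleDl : forall (a b : K) f, fs_set f ->
    is_lub_in fs_set [set a \*o f; b \*o f] ((a + b) \*o f)
}.

Definition fs_sort (K : idemSemiRingType) (X : Type)
  (V : functional_semimodule K X) : Type := {f : X -> K | fs_set V f}.
Coercion fs_sort : functional_semimodule >-> Sortclass.

Definition fs_fun (K : idemSemiRingType) (X : Type)
  (V : functional_semimodule K X) (f : fs_sort V) : X -> K := sval f.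
Coercion fs_fun : fs_sort >-> Funclass.

Section Order.
Variable S : nmodType.
Implicit Types x y z : S.

Lemma preceq_trans y x z : x ⪯ y -> y ⪯ z -> x ⪯ z.
Proof. by rewrite /preceq => xy yz; rewrite -yz addrA xy. Qed.

Lemma preceq_anti x y : x ⪯ y -> y ⪯ x -> x = y.
Proof. by rewrite /preceq => xy yx; rewrite -yx addrC. Qed.

Lemma preceq0 x : 0 ⪯ x.
Proof. exact: add0r. Qed.

Lemma is_ub2 x y z : is_ub [set x; y] z <-> x ⪯ z /\ y ⪯ z.
Proof.
split=> [H|[xz yz] q [->|->] //].
by split; apply: H; [left|right].
Qed.

Lemma is_lub_in_uniq (P Q : set S) x y :
  is_lub_in P Q x -> is_lub_in P Q y -> x = y.
Proof.
move=> [Px ux lx] [Py uy ly].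
by apply: preceq_anti; [exact: lx|exact: ly].
Qed.

End Order.

Lemma preceq_refl (K : idemSemiRingType) (X : Type) (f : X -> K) : f ⪯ f.
Proof. by rewrite /preceq funeqE => x; exact: addii. Qed.

Section FunctionalSemimoduleTheory.
Variables (K : idemSemiRingType) (X : Type) (V : functional_semimodule K X).
Implicit Types f g h : fs_sort V.

HB.instance Definition _ := gen_eqMixin (fs_sort V).
HB.instance Definition _ := gen_choiceMixin (fs_sort V).

Lemma fs_funP f : fs_set V f.
Proof. exact: (svalP f). Qed.

Lemma fs_fun_inj f g : f = g :> (X -> K) -> f = g.
Proof.
case: f g => [f fV] [g gV]; rewrite /fs_fun /= => fg.
by move: gV; rewrite -fg => gV; congr exist; exact: Prop_irrelevance.
Qed.

Definition fs_mk (u : X -> K) (uV : fs_set V u) : fs_sort V := exist _ u uV.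

Lemma fs_set0 : fs_set V 0.
Proof.
have [f fV] := fs_inh V; suff -> : (0 : X -> K) = 0 \*o f by exact: fs_scale.
by rewrite funeqE => x /=; rewrite mul0r.
Qed.

Definition fs_zero : fs_sort V := fs_mk fs_set0.

Lemma fs_add_subproof f g :
  {h : X -> K | is_lub_in (fs_set V) [set (f : X -> K); (g : X -> K)] h}.
Proof. by apply: cid; apply: fs_join; exact: fs_funP. Qed.

Lemma fs_add_in f g : fs_set V (sval (fs_add_subproof f g)).
Proof. by case: (svalP (fs_add_subproof f g)). Qed.

Definition fs_add f g : fs_sort V := fs_mk (fs_add_in f g).

Definition fs_scal (a : K) f : fs_sort V := fs_mk (fs_scale a (fs_funP f)).

Lemma fs_add_lub f g :
  is_lub_in (fs_set V) [set (f : X -> K); (g : X -> K)] (fs_add f g).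
Proof. exact: (svalP (fs_add_subproof f g)). Qed.

Lemma fs_addE f g h :
  is_lub_in (fs_set V) [set (f : X -> K); (g : X -> K)] h -> fs_add f g = h.
Proof. by move=> H; apply/fs_fun_inj/(is_lub_in_uniq (fs_add_lub f g) H). Qed.

Lemma fs_add_le f g h :
  (fs_add f g : X -> K) ⪯ h <-> (f : X -> K) ⪯ h /\ (g : X -> K) ⪯ h.
Proof.
have [_ /is_ub2[fs gs] l] := fs_add_lub f g; split=> [H|/is_ub2 H].
  by split; [exact: preceq_trans H|exact: preceq_trans H].
by apply: l H; exact: fs_funP.
Qed.

Lemma fs_eq_ub f g :
  (forall h, (f : X -> K) ⪯ h <-> (g : X -> K) ⪯ h) -> f = g.
Proof.
by move=> H; apply/fs_fun_inj/preceq_anti; apply/H; exact: preceq_refl.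
Qed.

Fact fs_addA : associative fs_add.
Proof.
move=> f g h; apply: fs_eq_ub => u; rewrite !fs_add_le.
by split=> [[? []]|[[]]].
Qed.

Fact fs_addC : commutative fs_add.
Proof.
by move=> f g; apply: fs_eq_ub => u; rewrite !fs_add_le; split=> -[].
Qed.

Fact fs_add0 : left_id fs_zero fs_add.
Proof.
move=> f; apply: fs_eq_ub => u; rewrite fs_add_le.
by split=> [[]|] //; split=> //; exact: preceq0.
Qed.

HB.instance Definition _ :=
  GRing.isNmodule.Build (fs_sort V) fs_addA fs_addC fs_add0.

Fact fs_scalA a b f : fs_scal a (fs_scal b f) = fs_scal (a * b) f.
Proof. by apply: fs_fun_inj; rewrite funeqE => x /=; exact: mulrA. Qed.

Fact fs_scal0 f : fs_scal 0 f = 0.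
Proof. by apply: fs_fun_inj; rewrite funeqE => x /=; exact: mul0r. Qed.

Fact fs_scal1 : left_id 1 fs_scal.
Proof. by move=> f; apply: fs_fun_inj; rewrite funeqE => x /=; exact: mul1r. Qed.

Fact fs_scalDr : right_distributive fs_scal +%R.
Proof.
move=> a f g; apply/esym/fs_addE.
by apply: fs_scaleDr (fs_add_lub f g); exact: fs_funP.
Qed.

Fact fs_scalDl f : {morph fs_scal^~ f : a b / a + b}.
Proof. by move=> a b; apply/esym/fs_addE/fs_scaleDl/fs_funP. Qed.

HB.instance Definition _ := GRing.Nmodule_isLSemiModule.Build K (fs_sort V)
  fs_scalA fs_scal0 fs_scal1 fs_scalDr fs_scalDl.

Lemma fs_scalE (a : K) f : (a *: f : fs_sort V) = a \*o f :> (X -> K).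
Proof. by []. Qed.

Lemma fs_addP f g :
  is_lub_in (fs_set V) [set (f : X -> K); (g : X -> K)] (f + g : fs_sort V).
Proof. exact: fs_add_lub. Qed.

Lemma fs_preceqE f g : f ⪯ g <-> (f : X -> K) ⪯ (g : X -> K).
Proof.
split=> [fg|fg].
  by have [_ /is_ub2[+ _] _] := fs_addP f g; rewrite fg.
apply: fs_addE; split; first exact: fs_funP.
  by apply/is_ub2; split=> //; exact: preceq_refl.
by move=> t _ /is_ub2[].
Qed.

End FunctionalSemimoduleTheory.

Definition fs_mod (K : idemSemiRingType) (X : Type)
  (V : functional_semimodule K X) : lSemiModType K := fs_sort V.
Coercion fs_mod : functional_semimodule >-> GRing.LSemiModule.type.

Section FunctionalNotions.
Variables (K : idemSemiRingType) (X : Type).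
Implicit Type V : functional_semimodule K X.

(* When K is b-complete every nonempty Q has an infimum in X -> K. *)
Definition functional_wedge_semimodule V : Prop :=
  fs_set V 0 /\
  forall (Q : set (X -> K)) (g : X -> K),
    Q `<=` fs_set V -> Q !=set0 -> is_glb Q g -> fs_set V g.

(* Closure under pointwise sums makes the sum of V the pointwise one; the last
   clause is the b-linearity of the inclusion of V in X -> K. *)
Definition functional_b_semimodule V : Prop :=
  [/\ forall f g : X -> K, fs_set V f -> fs_set V g -> fs_set V (f + g),
      b_complete_semimodule V
    & forall (Q : set V) (s : V),
        is_lub Q s -> is_lub [set (f : X -> K) | f in Q] (s : X -> K)].

Definition admissible V : Prop :=
  forall (f : X -> K) (x : X), fs_set V f -> f x <> 0 ->
    exists g : X -> K, [/\ fs_set V g, g x = 1 & f x \*o g ⪯ f].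

Definition has_integral_representation V (W : lSemiModType K)
    (A : {linear V -> W}) : Prop :=
  exists k : X -> W, forall f : V,
    bounded [set f x *: k x | x in [set: X]] /\
    is_lub [set f x *: k x | x in [set: X]] (A f).

Definition kernel_theorem_holds V : Prop :=
  forall W : lSemiModType K, b_complete_semimodule W ->
  forall A : {linear V -> W}, b_linear A -> has_integral_representation A.

End FunctionalNotions.

(* Main.v *)
(* For x in X let δ_x be the infimum in K(X) of the functions g in V with
   g(x) = 1, or 0 if there are none.  Infima in K(X) are pointwise, so
   δ_x(x) = 1 in the first case, while in the second case admissibility forces
   every f in V to vanish at x.  Admissibility also gives f(x) ⊙ δ_x ⪯ f, so f
   is the supremum in V of the functions f(x) ⊙ δ_x.  Applying A to this
   supremum yields the representation with k(x) = A δ_x. *)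
Require Import Defs.
From mathcomp Require Import all_boot all_algebra.

Set Implicit Arguments.
Unset Strict Implicit.
Unset Printing Implicit Defensive.

Import GRing.Theory.

Local Open Scope classical_set_scope.
Local Open Scope ring_scope.

Lemma preceq_funE (S : nmodType) (T : Type) (f g : T -> S) :
  f ⪯ g <-> forall t, f t ⪯ g t.
Proof. by rewrite /preceq funeqE. Qed.

Lemma preceq_mul2l (K : idemSemiRingType) (a b c : K) :
  b ⪯ c -> a * b ⪯ a * c.
Proof. by rewrite /preceq -mulrDr => ->. Qed.

Lemma is_lub_fun_app (S : nmodType) (T : Type) (Q : set (T -> S)) (s : T -> S)
    (t : T) :
  is_lub Q s -> is_lub [set q t | q in Q] (s t).
Proof.
move=> [us ls]; split=> [_ [q Qq <-]|v uv].
  by move/preceq_funE: (us q Qq); apply.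
pose s' u := if pselect (u = t) then v else s u.
have /ls/preceq_funE/(_ t) : is_ub Q s'.
  move=> q Qq; apply/preceq_funE => u; rewrite /s'; case: pselect => [ut|_] /=.
    by apply: uv; exists q; rewrite ?ut.
  by move/preceq_funE: (us q Qq); apply.
by rewrite /s'; case: pselect.
Qed.

Lemma exists_pointwise_glb (S : nmodType) (T : Type) (Q : set (T -> S)) :
  b_complete_semigroup S -> Q !=set0 ->
  exists g : T -> S, is_glb Q g /\ forall t, is_glb [set q t | q in Q] (g t).
Proof.
move=> [_ Sb] [q0 Qq0].
have /choice[g gP] t : exists s, is_glb [set q t | q in Q] s.
  have [|s [us ls]] := Sb (is_lb [set q t | q in Q]).
    by exists (q0 t) => k; apply; exists q0.
  exists s; split=> [_ [q Qq <-]|k]; last exact: us.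
  by apply: ls => k; apply; exists q.
exists g; split=> //; split=> [q Qq|h lh].
  by apply/preceq_funE => t; apply: (gP t).1; exists q.
apply/preceq_funE => t; apply: (gP t).2 => _ [q Qq <-].
by move/preceq_funE: (lh q Qq); apply.
Qed.

Section Delta.
Variables (K : idemSemiRingType) (X : Type) (V : functional_semimodule K X).
Hypotheses (K_bcomplete : b_complete_semiring K).
Hypotheses (V_wedge : functional_wedge_semimodule V) (V_adm : admissible V).

Lemma exists_delta (x : X) : exists d : V,
  forall f : V, f x * d x = f x /\ f x *: d ⪯ f.
Proof.
have [[K_idem K_sup] _ _] := K_bcomplete.
have [[g0 Qg0]|noQ] := pselect ([set g | fs_set V g /\ g x = 1] !=set0).
  have [d [d_glb d_pw]] := @exists_pointwise_glb K X
    [set g | fs_set V g /\ g x = 1] (conj K_idem K_sup) (ex_intro _ g0 Qg0).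
  have Vd : fs_set V d.
    by apply: (V_wedge.2 _ _ _ _ d_glb) => [g []//|]; exists g0.
  have dx1 : d x = 1.
    apply: preceq_anti; first by apply: (d_pw x).1; exists g0; case: Qg0.
    by apply: (d_pw x).2 => _ [g [_ gx1] <-]; rewrite gx1; exact: K_idem.
  exists (fs_mk Vd) => f; split; first by rewrite /fs_fun /= dx1 mulr1.
  apply/fs_preceqE; rewrite fs_scalE.
  have [fx0|/eqP fx0] := eqVneq (f x) 0.
    by apply/preceq_funE => y /=; rewrite fx0 mul0r; exact: preceq0.
  have [g [Vg gx1 fg]] := V_adm (fs_funP f) fx0.
  apply: preceq_trans fg; apply/preceq_funE => y; apply: preceq_mul2l.
  by have /preceq_funE := d_glb.1 g (conj Vg gx1); apply.
exists 0 => f; have fx0 : f x = 0.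
  have [//|/eqP fx0] := eqVneq (f x) 0.
  by have [g [Vg gx1 _]] := V_adm (fs_funP f) fx0; case: noQ; exists g.
by rewrite fx0 mul0r scale0r; split=> //; exact: preceq0.
Qed.

Lemma exists_delta_expansion : exists d : X -> V,
  forall f : V, is_lub [set f x *: d x | x in [set: X]] f.
Proof.
have /choice[d dP] := exists_delta.
exists d => f; split=> [_ [x _ <-]|u uu]; first by case: (dP x f).
apply/fs_preceqE/preceq_funE => x; rewrite -(dP x f).1.
have /fs_preceqE/preceq_funE : f x *: d x ⪯ u by apply: uu; exists x.
by apply.
Qed.

Lemma b_linear_integral_representation (W : lSemiModType K)
    (A : {linear V -> W}) : b_linear A -> has_integral_representation A.
Proof.
have [d dP] := exists_delta_expansion => A_blin.
exists (A \o d) => f.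
have AfP : is_lub [set f x *: (A \o d) x | x in [set: X]] (A f).
  have := A_blin _ _ (dP f); rewrite image_comp.
  by congr (is_lub _ _); apply: eq_imagel => x _ /=; rewrite linearZ.
by split=> //; exists (A f); case: AfP.
Qed.

End Delta.

Theorem theorem1 (K : idemSemiRingType) (K_bcomplete : b_complete_semiring K)
    (X : Type) (X_nonempty : inhabited X)
    (V : functional_semimodule K X)
    (V_wedge : functional_wedge_semimodule V) (V_adm : admissible V) :
  [/\ forall W : lSemiModType K, b_complete_semimodule W ->
      forall A : {linear V -> W}, b_linear A ->
      exists k : X -> W, forall f : V,
        bounded [set f x *: k x | x in [set: X]] /\
        is_lub [set f x *: k x | x in [set: X]] (A f),
      forall Y : Type, inhabited Y ->
      forall W : functional_semimodule K Y, functional_b_semimodule W ->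
      forall A : {linear V -> W}, b_linear A ->
      exists k : X -> Y -> K,
        [/\ forall x : X, fs_set W (k x),
            forall f : V,
              bounded [set w : W | exists x : X, f x \*o k x = w :> (Y -> K)]
          & forall (f : V) (y : Y),
              is_lub [set f x * k x y | x in [set: X]] ((A f : W) y)]
    & kernel_theorem_holds V].
Proof.
have repr := b_linear_integral_representation K_bcomplete V_wedge V_adm.
split=> [W _ A|Y _ W [_ _ W_incl] A A_blin|W _ A]; try exact: repr.
have [k kP] := repr W A A_blin.
exists (fun x => fs_fun (k x)); split=> [x|f|f y]; first exact: fs_funP.
  have [[s us] _] := kP f; exists s => w [x kw]; apply: us.
  by exists x => //; apply: fs_fun_inj; rewrite fs_scalE.
have := is_lub_fun_app y (W_incl _ _ (kP f).2).
by rewrite !image_comp.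
Qed.
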